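(* Let $G$ be a finite solvable BT-group with nilpotent residual $L$. Then the following statements are equivalent: (1) $G$ is an SST-group. (2) For every $p\in\pi(G)\setminus\pi(L)$ and every $p$-subgroup $P$ of $G$, $G$ has a $p$-subgroup $K_p$ such that $PK_p\in Syl_p(G)$ and $[P,\langle {K_p}^L\rangle]\leq O_p(G)$. (3) For every $p\in\pi(G)\setminus\pi(L)$ and every $p$-element $x$ of $G$, $G$ has a $p$-subgroup $K_p$ such that $\langle x\rangle K_p\in Syl_p(G)$ and $[x,\langle {K_p}^L\rangle]\leq O_p(G)$.
   Context: All groups are finite; $\pi(X)$ is the set of prime divisors of $|X|$ and $Syl_p(G)$ the set of Sylow $p$-subgroups of $G$. Two subgroups $A,B$ of a group permute if $AB=BA$. A supplement of $H$ in $G$ is a subgroup $K\le G$ with $G=HK$. A subgroup $H$ of a group $G$ is SS-permutable in $G$ if $H$ has a supplement $K$ in $G$ such that $H$ permutes with every Sylow subgroup of $K$ (for all primes). $G$ is an SST-group if SS-permutability is transitive: whenever $H\le K\le G$, $H$ is SS-permutable in $K$ and $K$ is SS-permutable in $G$, then $H$ is SS-permutable in $G$. A subgroup $H$ of $G$ is semipermutable in $G$ if $H$ permutes with every subgroup $X$ of $G$ such that $(|H|,|X|)=1$. $G$ is a BT-group if semipermutability is transitive: whenever $H\le K\le G$, $H$ is semipermutable in $K$ and $K$ is semipermutable in $G$, then $H$ is semipermutable in $G$. The nilpotent residual of $G$ is the intersection of all normal subgroups $N$ of $G$ such that $G/N$ is nilpotent. $\langle {K_p}^L\rangle$ is the subgroup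 generated by all conjugates ${K_p}^l=l^{-1}K_pl$ with $l\in L$. $[A,B]$ is the subgroup generated by all commutators $[a,b]$ with $a\in A$, $b\in B$, and $[x,B]$ is the subgroup generated by all $[x,b]$ with $b\in B$. $O_p(G)$ is the largest normal $p$-subgroup of $G$. *)

(* Defs.v *)
From mathcomp Require Import all_boot all_fingroup all_solvable.

Set Implicit Arguments.
Unset Strict Implicit.
Unset Printing Implicit Defensive.

Local Open Scope group_scope.

Section Definitions.

Variable gT : finGroupType.
Implicit Types G H K S X : {group gT}.

(* [commute A B] for subsets A and B of gT is A * B = B * A. *)
Definition SS_permutable H G : Prop :=
  H \subset G /\
  exists K : {group gT},
    [/\ K \subset G, H * K = G
      & forall (p : nat) S, prime p -> S \in 'Syl_p(K) -> commute (H : {set gT}) S].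

Definition SST_group G : Prop :=
  forall H K, H \subset K -> K \subset G ->
    SS_permutable H K -> SS_permutable K G -> SS_permutable H G.

Definition semipermutable H G : Prop :=
  H \subset G /\
  forall X, X \subset G -> coprime #|H| #|X| -> commute (H : {set gT}) X.

Definition BT_group G : Prop :=
  forall H K, H \subset K -> K \subset G ->
    semipermutable H K -> semipermutable K G -> semipermutable H G.

Definition nilpotent_residual G : {set gT} :=
  \bigcap_(N : {group gT} | (N <| G) && nilpotent (G / N)) N.

Canonical nilpotent_residual_group G := [group of nilpotent_residual G].

(* [p.-Sylow(G) A] only counts elements and cosets when A is a mere set: with
   G = 'S_3, p = 2 and A the product of two distinct subgroups of order 2 it
   holds although A is not a subgroup, so A is compared with a subgroup here. *)
Definition is_Syl (p : nat) G (A : {set gT}) : Prop :=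
  exists2 S : {group gT}, S \in 'Syl_p(G) & A = S.

Definition conj_closure (A B : {set gT}) : {set gT} :=
  <<\bigcup_(b in B) A :^ b>>.

End Definitions.

(* Main.v *)
Require Import Defs.
From mathcomp Require Import all_boot all_fingroup all_solvable.

Set Implicit Arguments.
Unset Strict Implicit.
Unset Printing Implicit Defensive.

Local Open Scope group_scope.

(** Let [G] be a solvable BT-group with nilpotent residual [L].

    The structure of [G] comes first. By transitivity every subnormal subgroup of
    [G] is semipermutable, so that the [p']-elements of [G] normalise every
    subgroup of ['O_p(G)]; in particular they act on the Frattini quotient of
    ['O_p(G)] as scalars. It follows that the [p']-elements of [G] are central
    modulo the centraliser of ['O_p(G)]. The corresponding quotient of [G] is thus
    nilpotent, so [L] centralises every ['O_p(G)], that is, the Fitting subgroup,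
    which contains its centraliser: [L] is abelian
    ([BT_residual_abelian]). Then any two subgroups of coprime orders, one of which
    is a [p]-group, permute ([BT_pgroups_permute]). A nontrivial scalar on a
    Frattini quotient has no nontrivial fixed point, which makes [L] a Hall
    subgroup ([BT_residual_Hall]), all of whose subgroups are normal in [G]
    ([BT_residual_sub_normal]). So the derived subgroup of [G] centralises [L], and
    for distinct primes [p] and [q] not dividing [#|L|], all [p]-elements commute
    with all [q]-elements ([BT_pi'_residual_cent]). Finally, for such a [p], the
    [p]-subgroups centralising [L] lie in ['O_p(G)].

    If [G] is an SST-group, then each [p]-subgroup [P] with [p] not dividing [#|L|]
    is SS-permutable, being SS-permutable in the subnormal subgroup [P L]. The
    corresponding supplement contains [L], so [P] permutes with all the
    [L]-conjugates of one of its Sylow [p]-subgroups; the commutators centralise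
    [L] and lie in a [p]-group, hence in ['O_p(G)].

    Conversely, the condition on elements says that if [x] acts nontrivially on a
    subgroup of prime order of [L] then its partner [K_p] acts trivially on it.
    Applied to [x] and to products [x * k] with [k] in [K_p], this forces [K_p] to
    centralise [L] as soon as [x] does not ([elt_supplement_cent_residual]).
    Therefore a [p]-subgroup that is not in ['O_p(G)] covers a Sylow
    [p]-subgroup modulo ['O_p(G)]. This makes every subgroup of [G] SS-permutable
    ([SS_permutable_of_pgroups]), and SS-permutability is then trivially
    transitive. *)

(** * The nilpotent residual *)

Section Residual.

Variable gT : finGroupType.
Implicit Types (p : nat) (A D G H K N P Q R S T U V X Y : {group gT}).

Lemma nilpotent_quotient_lcn G N :
  N <| G -> nilpotent (G / N) -> 'L_(#|G|.+1)(G) \subset N.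
Proof.
move=> nsNG nilQ; have nNG := normal_norm nsNG.
have sLG := lcn_sub #|G|.+1 G.
rewrite -quotient_sub1 ?(subset_trans sLG) //.
rewrite /quotient morphim_lcn // -/(quotient G N).
suff -> : 'L_(#|G|.+1)(G / N) = 1 by [].
apply/(lcn_nil_classP #|G| nilQ); move: (nilQ); rewrite nilpotent_class => /ltnW.
by move/leq_trans; apply; apply: leq_quotient.
Qed.

(** The residual is a term of the lower central series: the index [#|G|.+1] is
    large enough since the class of a nilpotent group is less than its order. *)
Lemma nilpotent_residualE G : nilpotent_residual G = 'L_(#|G|.+1)(G).
Proof.
apply/eqP; rewrite eqEsubset; apply/andP; split.
  apply: bigcap_inf; rewrite lcn_normal /=; apply/lcnP; exists #|G|.
  by rewrite -[LHS]morphim_lcn ?lcn_norm //= -/(quotient _ _) trivg_quotient.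
by apply/bigcapsP=> N /andP[nsNG nilQ]; apply: nilpotent_quotient_lcn.
Qed.

Lemma nilpotent_residual_normal G : nilpotent_residual G <| G.
Proof. by rewrite nilpotent_residualE lcn_normal. Qed.

Lemma nilpotent_residual_nil G : nilpotent (G / nilpotent_residual G).
Proof.
rewrite nilpotent_residualE; apply/lcnP; exists #|G|.
by rewrite -[LHS]morphim_lcn ?lcn_norm //= -/(quotient _ _) trivg_quotient.
Qed.

Lemma nilpotent_residual_sub G N :
  N <| G -> nilpotent (G / N) -> nilpotent_residual G \subset N.
Proof. by rewrite nilpotent_residualE; apply: nilpotent_quotient_lcn. Qed.

End Residual.

(** * Subnormal subgroups of BT-groups *)

Section Subnormal.

Variable gT : finGroupType.
Implicit Types (p : nat) (A D G H K N P Q R S T U V X Y : {group gT}).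

Lemma subnormal_pcore p G P : P <|<| G -> p.-group P -> P \subset 'O_p(G).
Proof.
have [n] := ubnP #|G|; elim: n => // n IHn in G * => /ltnSE leGn snPG pP.
case: (subnormalEr snPG) => [<- | [K [snPK nsKG ltKG]]].
  by rewrite pcore_pgroup_id.
apply: subset_trans (IHn K _ snPK pP) _.
  exact: leq_trans (proper_card ltKG) leGn.
apply: pcore_max (pcore_pgroup _ _) _.
exact: gFnormal_trans.
Qed.

(** A relation between subgroups that contains normality and can be composed
    below [G] holds between every subnormal subgroup and [G]. *)
Lemma subnormal_transitive_rel (E : {group gT} -> {group gT} -> Prop) G H :
    (forall X Y, X <| Y -> E X Y) ->
    (forall X Y, X \subset Y -> Y \subset G -> E X Y -> E Y G -> E X G) ->
  H <|<| G -> E H G.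
Proof.
move=> normalE transE; have [n] := ubnP (#|G| - #|H|).
elim: n => // n IHn in H * => /ltnSE leGHn snHG.
case: (subnormalEl snHG) => [/group_inj-> | [K [nsHK snKG ltHK]]].
  exact: normalE.
have [sHK sKG] := (normal_sub nsHK, subnormal_sub snKG).
apply: (transE H K) => //; first exact: normalE.
apply: IHn snKG; apply: leq_trans leGHn; apply: ltn_sub2l (proper_card ltHK).
exact: leq_trans (proper_card ltHK) (subset_leq_card sKG).
Qed.

Lemma normal_semipermutable H K : H <| K -> semipermutable H K.
Proof.
case/andP=> sHK nHK; split=> // X sXK _.
by apply/esym/normC/(subset_trans sXK).
Qed.

Lemma BT_subnormal_semipermutable G H :
  BT_group G -> H <|<| G -> semipermutable H G.
Proof. exact: subnormal_transitive_rel normal_semipermutable. Qed.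

(** Indeed [U <[b]>] is a subgroup, it meets [V] in [U], and [V] is normal. *)
Lemma commute_p'elt_norm p G V U (b : gT) :
    V <| G -> p.-group V -> U \subset V -> b \in G -> p^'.-elt b ->
  commute (U : {set gT}) <[b]> -> b \in 'N(U).
Proof.
move=> nsVG pV sUV Gb p'b cUb.
have tiVb : V :&: <[b]> = 1 by apply: coprime_TIg; apply: pnat_coprime pV p'b.
have defU : (U <*> <[b]>) :&: V = U.
  rewrite comm_joingE // -group_modl // (setIC <[b]>) tiVb mulg1 //.
rewrite -cycle_subG -[in X in _ \subset X]defU.
apply: normsI; first by rewrite (subset_trans (joing_subr U _)) ?normG.
by rewrite cycle_subG (subsetP (normal_norm nsVG)).
Qed.

(** The source of all power automorphisms below: the [p']-elements of a BT-group
    normalise every subgroup of its [p]-core. *)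
Lemma BT_p'elt_norm_sub_pcore p G U (b : gT) :
    BT_group G -> U \subset 'O_p(G) -> b \in G -> p^'.-elt b -> b \in 'N(U).
Proof.
move=> BTG sUO Gb p'b; have pO := pcore_pgroup p G.
have snU: U <|<| G.
  apply: subnormal_trans (normal_subnormal (pcore_normal p G)).
  exact: nilpotent_subnormal (pgroup_nil pO) sUO.
apply: (commute_p'elt_norm (pcore_normal p G) pO sUO Gb p'b).
apply: (BT_subnormal_semipermutable BTG snU).2; first by rewrite cycle_subG.
exact: pnat_coprime (pgroupS sUO pO) p'b.
Qed.

End Subnormal.

(** * Automorphisms of a p-group that stabilise every cyclic subgroup *)

Section ScalarAction.

Variable gT : finGroupType.
Implicit Types (p : nat) (A D G H K N P Q R S T U V X Y : {group gT}).

(** An automorphism of an elementary abelian group that stabilises every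
    cyclic subgroup is a scalar. *)
Lemma abelem_power_scalar p V (k : gT) :
    p.-abelem V -> (forall v, v \in V -> v ^ k \in <[v]>) ->
  exists i, forall v, v \in V -> v ^ k = v ^+ i.
Proof.
move=> abV Vk; have /centsP cVV := abelem_abelian abV.
have [-> | /trivgPn[u Vu ntu]] := eqsVneq V 1.
  by exists 0 => v /set1P->; rewrite conj1g.
have /cycleP[i defuk] := Vk u Vu; exists i => v Vv.
have [/cycleP[j ->] | notuv] := boolP (v \in <[u]>).
  by rewrite conjXg defuk -!expgM mulnC.
have ntv : v != 1 by apply: contraNneq notuv => ->; apply: group1.
have ou := abelem_order_p abV Vu ntu; have ov := abelem_order_p abV Vv ntv.
have p_pr : prime p.
  have ntV: V :!=: 1 by apply/trivgPn; exists u.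
  by have [] := pgroup_pdiv (abelem_pgroup abV) ntV.
have tiuv : <[v]> :&: <[u]> = 1.
  by apply: prime_TIg; rewrite ?cycle_subG // -orderE ov.
have /cycleP[j defvk] := Vk v Vv.
(* The exponents for [u] and [v] agree with the one for [u * v]. *)
have /cycleP[m defuvk] := Vk (u * v) (groupM Vu Vv).
have cuv: commute u v by apply: cVV.
have{defuvk} eq_uv : u ^+ i * v ^+ j = u ^+ m * v ^+ m.
  by rewrite -defuk -defvk -expgMn // -defuvk conjMg.
have eq1: (u ^+ m)^-1 * u ^+ i = v ^+ m * (v ^+ j)^-1.
  by apply: (canRL (mulgK _)); rewrite -mulgA eq_uv mulKg.
have: v ^+ m * (v ^+ j)^-1 \in <[v]> :&: <[u]>.
  rewrite inE -{2}eq1 !groupM ?groupV ?mem_cycle //.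
rewrite tiuv => /set1P eqv1.
have /eqP: u ^+ m = u ^+ i by apply/eqP; rewrite eq_mulVg1 eq1 eqv1.
rewrite eq_expg_mod_order ou -ov -eq_expg_mod_order => /eqP <-.
by rewrite defvk; apply/esym/eqP; rewrite eq_mulgV1 eqv1.
Qed.

(** A coprime action trivial modulo the Frattini subgroup is trivial. *)
Lemma coprime_cent_Frattini p V A :
    p.-group V -> A \subset 'N(V) -> coprime #|V| #|A| ->
  [~: V, A] \subset 'Phi(V) -> A \subset 'C(V).
Proof.
move=> pV nVA coVA sRPhi.
have nPhiA : A \subset 'N('Phi(V)) := char_norm_trans (Phi_char V) nVA.
have nPhiV := normal_norm (Phi_normal V).
have cVbA: V / 'Phi(V) \subset 'C(A / 'Phi(V)) by rewrite quotient_cents2.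
have := coprime_quotient_cent (Phi_sub V) nPhiA coVA (pgroup_sol pV).
rewrite (setIidPl cVbA) => eqCV.
have defV: 'Phi(V) <*> 'C_V(A) = V.
  apply/eqP; rewrite eqEsubset join_subG Phi_sub subsetIl /=.
  rewrite norm_joinEr ?subIset ?nPhiV // -quotientSK //.
  by rewrite eqCV.
by have := Phi_nongen defV; rewrite genGid centsC => <-; apply: subsetIr.
Qed.

End ScalarAction.

Section FrattiniAction.

Variable gT : finGroupType.
Implicit Types (p : nat) (A D G H K N P Q R S T U V X Y : {group gT}).

Lemma power_scalar_Frattini p V (k : gT) :
    p.-group V -> (forall v, v \in V -> k \in 'N(<[v]>)) ->
  k \in 'N(V) /\
  exists i, forall v, v \in V / 'Phi(V) -> v ^ (coset 'Phi(V) k) = v ^+ i.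
Proof.
move=> pV nVk; have nk: k \in 'N(V).
  apply/normP/eqP; rewrite eqEcard cardJg leqnn andbT.
  apply/subsetP=> _ /imsetP[v Vv ->].
  have: v ^ k \in <[v]> by rewrite memJ_norm ?cycle_id ?nVk.
  by apply/subsetP; rewrite cycle_subG.
split=> //.
have nPhik: k \in 'N('Phi(V)).
  by rewrite -cycle_subG (char_norm_trans (Phi_char V)) ?cycle_subG.
apply: (abelem_power_scalar (Phi_quotient_abelem pV)).
move=> _ /morphimP[v nv Vv ->]; rewrite -morphJ // -morphim_cycle //.
apply: mem_morphim; first by rewrite groupJ.
by rewrite memJ_norm ?cycle_id ?nVk.
Qed.

(** The scalar induced by [k] on [V / 'Phi(V)] is either [1], and then [k]
    centralises [V], or not, and then [[V, k]] covers [V / 'Phi(V)]. *)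
Lemma power_cent_or_comm p V (k : gT) :
    p.-group V -> (forall v, v \in V -> k \in 'N(<[v]>)) -> p^'.-elt k ->
  k \in 'C(V) \/ V \subset [~: V, <[k]>].
Proof.
move=> pV nVk p'k; have [nk [i Vk]] := power_scalar_Frattini pV nVk.
have [-> | ntV] := eqsVneq V 1; first by right; apply: sub1G.
have [p_pr _ _] := pgroup_pdiv pV ntV.
have nPhiV := normal_norm (Phi_normal V).
have nPhik: <[k]> \subset 'N('Phi(V)).
  by rewrite (char_norm_trans (Phi_char V)) ?cycle_subG.
have nPhik1: k \in 'N('Phi(V)) by rewrite -cycle_subG.
have abV := Phi_quotient_abelem pV.
(* [p.-1 + i] stands for the exponent [i - 1], as [v ^+ p = 1]. *)
have Vd v : v \in V / 'Phi(V) -> [~ v, coset 'Phi(V) k] = v ^+ (p.-1 + i).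
  move=> Vv; rewrite expgD commgEl Vk //; congr (_ * _).
  apply: (mulgI v); rewrite mulgV -expgS prednK ?prime_gt0 //.
  by have [_ ->] := abelemP p_pr abV.
have sRV : [~: V, <[k]>] \subset V by rewrite commg_subl cycle_subG.
have [p_d | ] := boolP (p %| p.-1 + i).
  left; rewrite -cycle_subG; apply: (coprime_cent_Frattini pV) => //.
  - by rewrite cycle_subG.
  - exact: pnat_coprime pV p'k.
  rewrite -quotient_cents2 // quotient_cycle // cent_cycle.
  apply/subsetP=> v Vv; apply/cent1P/commgP; rewrite Vd //.
  rewrite -order_dvdn; apply: dvdn_trans p_d.
  by case/abelemP: abV => // _ /(_ v Vv)/eqP; rewrite order_dvdn.
rewrite -prime_coprime // => co_pd; right; suff: 'Phi(V) <*> [~: V, <[k]>] = V.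
  by move/Phi_nongen; rewrite genGid => {1}<-.
apply/eqP; rewrite eqEsubset join_subG Phi_sub sRV /=.
rewrite norm_joinEr ?(subset_trans sRV) // -quotientSK //.
apply/subsetP=> v Vv.
have: v ^+ (p.-1 + i) \in [~: V, <[k]>] / 'Phi(V).
  rewrite quotientR // quotient_cycle // -Vd //.
  by apply: mem_commg => //; apply: cycle_id.
have cov : coprime #|<[v]>| (p.-1 + i).
  rewrite -orderE; apply: coprime_dvdl co_pd.
  by case/abelemP: abV => // _ /(_ v Vv)/eqP; rewrite order_dvdn.
by move/(groupX (expg_invn <[v]> (p.-1 + i))); rewrite expgK ?cycle_id.
Qed.

End FrattiniAction.

Section PowerAction.

Variable gT : finGroupType.
Implicit Types (p : nat) (A D G H K N P Q R S T U V X Y : {group gT}).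

(** The automorphism group of a cyclic group is abelian. *)
Lemma der1_cent_norm_cycles D V :
  (forall v, v \in V -> D \subset 'N(<[v]>)) -> D^`(1) \subset 'C(V).
Proof.
move=> nVD; rewrite gen_subG; apply/subsetP=> _ /imset2P[x y Dx Dy ->].
have DJ v z : v \in V -> z \in D -> v ^ z \in <[v]>.
  by move=> Vv Dz; rewrite memJ_norm ?cycle_id ?(subsetP (nVD v Vv)).
have DC v : v \in V -> v ^ (x * y) = v ^ (y * x).
  move=> Vv; have /cycleP[i vx] := DJ v x Vv Dx.
  have /cycleP[j vy] := DJ v y Vv Dy.
  by rewrite !conjgM vx vy !conjXg vx vy -!expgM mulnC.
apply/centP=> v Vv; apply/esym/commgP/conjg_fixP.
pose w := v ^ (y * x)^-1.
have Vw: w \in V.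
  have: w \in <[v]> by apply: DJ; rewrite // groupV groupM.
  by apply/subsetP; rewrite cycle_subG.
have ->: [~ x, y] = (y * x)^-1 * (x * y).
  by rewrite commgEl invMg conjgE !mulgA.
by rewrite conjgM -/w DC // /w conjgKV.
Qed.

Lemma pgroup_p_elt pi G : (forall x, x \in G -> pi.-elt x) -> pi.-group G.
Proof.
move=> piG; apply/pgroupP=> p p_pr /Cauchy[] // x Gx ox.
by have := piG x Gx; rewrite /p_elt ox pnatE.
Qed.

End PowerAction.

Section CentralElements.

Variable gT : finGroupType.
Implicit Types (p : nat) (A D G H K N P Q R S T U V X Y : {group gT}).

Lemma nilpotent_p'elt_central p G :
  (forall b, b \in G -> p^'.-elt b -> b \in 'C(G)) -> nilpotent G.
Proof.
move=> cGp'; rewrite -quotient_center_nil; apply: (@pgroup_nil _ p).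
apply: pgroup_p_elt => _ /morphimP[x nx Gx ->].
rewrite -(consttC p x) morphM ?groupX //.
have Zx: x.`_p^' \in 'Z(G).
  by rewrite inE groupX //=; apply: cGp'; rewrite ?p_elt_constt // groupX.
by rewrite [X in _ * X]coset_id // mulg1 morph_p_elt ?p_elt_constt // groupX.
Qed.

End CentralElements.

Section NilpotentAction.

Variable gT : finGroupType.
Implicit Types (p : nat) (A D G H K N P Q R S T U V X Y : {group gT}).

(** A [p']-element [b] acts on [V / 'Phi(V)] as a scalar, so [[b, g]] acts
    trivially there, for every [g] in [G]. The elements of [G] normalising all
    cyclic subgroups of [V] induce an abelian group on [V], in which [[b, g]] has
    order prime to [p]; hence [[b, g]] centralises [V]. So the [p']-elements of
    [G / 'C_G(V)] are central. *)
Lemma nilpotent_quotient_cent_power p G V :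
    V <| G -> p.-group V ->
    (forall b, b \in G -> p^'.-elt b -> forall v, v \in V -> b \in 'N(<[v]>)) ->
  nilpotent (G / 'C_G(V)).
Proof.
move=> nsVG pV nVp'; set C := 'C_G(V).
have [sVG nVG] := andP nsVG.
have nsCG : C <| G by have := subcent_normal G V; rewrite (setIidPl nVG).
have nCG := normal_norm nsCG.
(* The elements of [G] inducing power automorphisms on [V]. *)
pose D := (G :&: \bigcap_(v in V) 'N(<[v]>))%G.
have memD x :
  reflect (x \in G /\ forall v, v \in V -> x \in 'N(<[v]>)) (x \in D).
  by apply: (iffP setIP) => -[Gx /bigcapP nVx]; split.
have sDG : D \subset G := subsetIl _ _.
have nVD v : v \in V -> D \subset 'N(<[v]>).
  by move=> Vv; apply/subsetP=> x /memD[_ ->].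
have DJ d g : d \in D -> g \in G -> d ^ g \in D.
  move=> /memD[Gd nVd] Gg; apply/memD; split; first exact: groupJ.
  move=> v Vv; have Vvg: v ^ g^-1 \in V.
    by rewrite memJ_norm // groupV (subsetP nVG).
  by have := nVd _ Vvg; rewrite cycleJ normJ mem_conjgV.
have abDC : abelian (D / C).
  by rewrite sub_der1_abelian // subsetI der1_cent_norm_cycles // gFsub_trans.
have cenp' b : b \in G -> p^'.-elt b -> [~: [set b], G] \subset C.
  move=> Gb p'b; rewrite gen_subG; apply/subsetP=> _ /imset2P[_ g /set1P-> Gg ->].
  have Db : b \in D by apply/memD; split=> // v Vv; apply: nVp'.
  have Dbg : b ^ g \in D by apply: DJ.
  have Dbbg : [~ b, g] \in D by rewrite commgEl groupM ?groupV.
  set d := [~ b, g] in Dbbg *.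
  have nCd : d \in 'N(C) by rewrite (subsetP nCG) // (subsetP sDG).
  have nCb : b \in 'N(C) by rewrite (subsetP nCG).
  have nCbg : b ^ g \in 'N(C) by rewrite (subsetP nCG) ?groupJ.
  have p'dC : p^'.-elt (coset C d).
    rewrite /d commgEl morphM ?groupV // morphV //; apply: p_eltM.
    - by apply: (centsP abDC); rewrite ?groupV mem_quotient.
    - by rewrite p_eltV morph_p_elt.
    - by rewrite morph_p_elt // p_eltJ.
  have Vp'd : d.`_p^' \in C.
    have Dd : d.`_p^' \in D by apply: groupX.
    rewrite inE (subsetP sDG) //= -cycle_subG; apply: (coprime_cent_Frattini pV).
    - by rewrite cycle_subG (subsetP nVG) // (subsetP sDG).
    - exact: pnat_coprime pV (p_elt_constt _ _).
    have nPhid : d \in 'N('Phi(V)).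
      by rewrite (subsetP (char_norm_trans (Phi_char V) nVG)) // (subsetP sDG).
    have nPhi g0 : g0 \in G -> g0 \in 'N('Phi(V)).
      by move/(subsetP (char_norm_trans (Phi_char V) nVG)).
    have nPhiV := normal_norm (Phi_normal V).
    rewrite -quotient_cents2 ?cycle_subG ?nPhi ?(subsetP sDG) //.
    rewrite quotient_cycle ?nPhi ?(subsetP sDG) // centsC cycle_subG.
    rewrite morphX // groupX //; apply/centP => _ /morphimP[v nv Vv ->].
    have [_ [i Vi]] := power_scalar_Frattini pV (nVp' b Gb p'b).
    set B := coset 'Phi(V) b in Vi; set W := coset 'Phi(V) g.
    rewrite /d morphR ?nPhi //= -/B -/W.
    have VbW w : w \in V / 'Phi(V) -> w ^ W^-1 \in V / 'Phi(V).
      move=> /morphimP[u nu Vu ->]; rewrite /W -morphV ?nPhi //.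
      rewrite -morphJ ?groupV ?nPhi // ?(subsetP sVG) //.
      by rewrite mem_quotient // memJ_norm // groupV (subsetP nVG).
    have Vv' : coset 'Phi(V) v \in V / 'Phi(V) by rewrite mem_quotient.
    apply/esym/commgP/conjg_fixP.
    have ->: [~ B, W] = B^-1 * (W^-1 * B * W) by rewrite commgEl conjgE !mulgA.
    have VB w : w \in V / 'Phi(V) -> w ^ B^-1 \in V / 'Phi(V).
      move=> /morphimP[u nu Vu ->]; rewrite /B -morphV ?nPhi //.
      rewrite -morphJ ?groupV ?nPhi // ?(subsetP sVG) //.
      by rewrite mem_quotient // memJ_norm // groupV (subsetP nVG).
    rewrite conjgM; set w := _ ^ B^-1; have Vw: w \in V / 'Phi(V) by apply: VB.
    by rewrite !conjgM Vi ?VbW // conjXg conjgKV -Vi // /w conjgKV.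
  have pdC : p.-elt (coset C d).
    rewrite -(consttC p d) morphM ?groupX // [X in _ * X]coset_id // mulg1.
    by rewrite morph_p_elt ?p_elt_constt // groupX.
  by apply: coset_idr nCd _; rewrite -(constt_p_elt pdC); apply/constt1P.
apply: (@nilpotent_p'elt_central _ p) => _ /morphimP[x nx Gx ->] p'x.
rewrite -(constt_p_elt p'x) -morph_constt // -sub1set.
set b := x.`_p^'; have Gb : b \in G by rewrite groupX.
have nCb : b \in 'N(C) by rewrite groupX.
rewrite -quotient_set1 //= quotient_cents2 ?sub1set // cenp' //.
exact: p_elt_constt.
Qed.

End NilpotentAction.

(** * The residual of a solvable BT-group is abelian *)

Section BTResidual.

Variable gT : finGroupType.
Implicit Types (p : nat) (A D G H K L N P Q R S T U V X Y : {group gT}).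

Lemma cosetpre_subnormal K G (A : {group coset_of K}) :
  K <| G -> A <|<| G / K -> coset K @*^-1 A <|<| G.
Proof.
move=> nsKG; have [n] := ubnP (#|G / K| - #|A|).
elim: n => // n IHn in A * => /ltnSE leGA snAG.
case: (subnormalEl snAG) => [-> | [B [nsAB snBG ltAB]]].
  by rewrite quotientGK ?subnormal_refl.
have sBG := subnormal_sub snBG.
apply: (@subnormal_trans _ (coset K @*^-1 B)).
  by apply: normal_subnormal; rewrite cosetpre_normal.
apply: IHn snBG; apply: leq_trans leGA.
apply: ltn_sub2l (proper_card ltAB).
by apply: leq_trans (proper_card ltAB) (subset_leq_card sBG).
Qed.

Lemma nilpotent_quotient_subnormal L G H :
    L <| G -> nilpotent (G / L) -> L \subset H -> H \subset G -> H <|<| G.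
Proof.
move=> nsLG nilQ sLH sHG; have nsLH := normalS sLH sHG nsLG.
rewrite -(quotientGK nsLH); apply: cosetpre_subnormal => //.
by apply: nilpotent_subnormal nilQ _; apply: quotientS.
Qed.

(** Let [C] be the centraliser and [Z] its intersection with the Fitting subgroup.
    An abelian normal subgroup of [G / Z] inside [C / Z] lifts to a normal
    subgroup of [G] that is nilpotent because [Z] is central in it, hence it is
    contained in [Z]. *)
Lemma cent_sub_Fitting G : solvable G -> 'C_G('F(G)) \subset 'F(G).
Proof.
move=> solG; set C := 'C_G('F(G)).
have nsCG : C <| G.
  have := subcent_normal G 'F(G).
  by rewrite (setIidPl (normal_norm (Fitting_normal G))).
pose Z := (C :&: 'F(G))%G; have nsZG : Z <| G := normalI nsCG (Fitting_normal G).
have nZC : C \subset 'N(Z) := subset_trans (normal_sub nsCG) (normal_norm nsZG).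
apply: contraT => ntC.
have {ntC}ntCZ : C / Z != 1.
  by apply: contra ntC; rewrite -subG1 quotient_sub1 // subsetI => /andP[].
have solCZ : solvable (C / Z).
  exact: quotient_sol (solvableS (normal_sub nsCG) solG).
have := solvable_norm_abelem solCZ (quotient_normal Z nsCG) ntCZ.
case=> Mb [sMbC nsMbG ntMb /is_abelemP[p _ /abelem_abelian abMb]].
have [M defMb sZM nsMG] := inv_quotientN nsZG nsMbG.
have nZM := subset_trans (normal_sub nsMG) (normal_norm nsZG).
have sMC : M \subset C.
  by have := sMbC; rewrite defMb quotientSGK // subsetIl.
have sMF : M \subset 'F(G).
  apply: Fitting_max => //; rewrite -quotient_center_nil; apply: abelian_nil.
  apply: sub_der1_abelian; have sM'Z : M^`(1) \subset Z.
    by apply: der1_min; rewrite // -defMb.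
  rewrite (subset_trans sM'Z) // subsetI sZM centsC (subset_trans sMC) //.
  by rewrite (subset_trans (subsetIr _ _)) // centS // subsetIr.
by case/negP: ntMb; rewrite defMb -subG1 quotient_sub1 // subsetI sMC.
Qed.

Lemma BT_nilpotent_quotient_cent_pcore p G :
  BT_group G -> nilpotent (G / 'C_G('O_p(G))).
Proof.
move=> BTG; apply: (@nilpotent_quotient_cent_power _ p) => //.
- exact: pcore_normal.
- exact: pcore_pgroup.
move=> b Gb p'b v Ov.
by have := @BT_p'elt_norm_sub_pcore _ p G <[v]>%G b BTG; rewrite cycle_subG; apply.
Qed.

Lemma BT_residual_cent_Fitting G :
  BT_group G -> nilpotent_residual G \subset 'C('F(G)).
Proof.
move=> BTG; rewrite centsC FittingEgen gen_subG; apply/bigcupsP=> p _.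
rewrite centsC; apply: subset_trans (subsetIr G _).
apply: nilpotent_residual_sub (BT_nilpotent_quotient_cent_pcore _ BTG).
have := subcent_normal G 'O_p(G).
by rewrite (setIidPl (normal_norm (pcore_normal p G))).
Qed.

Lemma BT_residual_sub_Fitting G :
  solvable G -> BT_group G -> nilpotent_residual G \subset 'F(G).
Proof.
move=> solG BTG; apply: subset_trans (cent_sub_Fitting solG).
rewrite subsetI BT_residual_cent_Fitting // normal_sub //.
exact: nilpotent_residual_normal.
Qed.

Lemma BT_residual_abelian G :
  solvable G -> BT_group G -> abelian (nilpotent_residual G).
Proof.
move=> solG BTG; rewrite /abelian.
apply: subset_trans (BT_residual_cent_Fitting BTG) _.
exact: centS (BT_residual_sub_Fitting solG BTG).
Qed.

(** Every [p]-subgroup of [G] permutes with every subgroup of [G] of order prime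
    to [p]. *)
Definition pgroups_permute p G :=
  forall P X, P \subset G -> X \subset G -> p.-group P -> p^'.-group X ->
    commute (P : {set gT}) X.

(** [P] is semipermutable in the subnormal subgroup [P L], because the subgroups
    of [P L] of order prime to [p] lie in the abelian group [L], hence are
    themselves subnormal, thus semipermutable, in [G]. *)
Lemma BT_pgroups_permute p G :
  solvable G -> BT_group G -> pgroups_permute p G.
Proof.
move=> solG BTG P X sPG sXG pP p'X.
pose L := nilpotent_residual_group G.
have nsLG : L <| G := nilpotent_residual_normal G.
have [sLG nLG] := andP nsLG.
have abL : abelian L := BT_residual_abelian solG BTG.
have sPLG : P <*> L \subset G by rewrite join_subG sPG.
have snPL : P <*> L <|<| G.
  apply: nilpotent_quotient_subnormal nsLG (nilpotent_residual_nil G) _ sPLG.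
  exact: joing_subr.
suff spP : semipermutable P G by apply: spP.2 => //; apply: pnat_coprime pP p'X.
apply: (BTG P (P <*> L)%G) => //; first exact: joing_subl.
  split=> [|Y sYPL coPY]; first exact: joing_subl.
  have sYG := subset_trans sYPL sPLG.
  have sYL : Y \subset L.
    rewrite -quotient_sub1 ?(subset_trans sYG) //.
    have: Y / L \subset P / L.
      by rewrite -(quotientYidr (subset_trans sPG nLG)) quotientS.
    move/setIidPl <-; rewrite setIC coprime_TIg //.
    by rewrite coprime_morph.
  have snY: Y <|<| G.
    apply: subnormal_trans (normal_subnormal nsLG).
    by apply: normal_subnormal; rewrite -sub_abelian_normal.
  apply/esym; apply: (BT_subnormal_semipermutable BTG snY).2 => //.
  by rewrite coprime_sym.
exact: BT_subnormal_semipermutable.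
Qed.

End BTResidual.

(** * The residual of a solvable BT-group is a Hall subgroup *)

Section PermutingPGroups.

Variable gT : finGroupType.
Implicit Types (p : nat) (A D G H K N P Q R S T U V X Y : {group gT}).

Lemma pgroups_permute_quotient p G N :
  N <| G -> p^'.-group N -> pgroups_permute p G -> pgroups_permute p (G / N).
Proof.
move=> nsNG p'N permG Pb Xb sPbG sXbG pPb p'Xb.
have [X defX sNX sXG] := inv_quotientS nsNG sXbG.
have [H defH sNH sHG] := inv_quotientS nsNG sPbG.
have [P sylP] := Sylow_exists p H.
have [sPH pP _] := and3P sylP.
have nNG := normal_norm nsNG.
have defP : Pb = P / N :> {set _}.
  apply/esym/(pHall_id _ pPb); rewrite defH.
  by apply: quotient_pHall => //; apply: subset_trans sPH (subset_trans sHG nNG).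
have p'X : p^'.-group X.
  by rewrite -(pquotient_pgroup p'N) -?defX // (subset_trans sXG).
have sPG := subset_trans sPH sHG.
rewrite /commute defP defX -!quotientMl ?(subset_trans sXG, subset_trans sPG) //.
by rewrite (permG P X).
Qed.

(** The Sylow [p]-subgroup [S] is normal, and a [p']-element [k] that does not
    centralise [S] satisfies [S = [S, k]], which is contained in [N]. *)
Lemma pgroups_permute_nil_or_Sylow p G N :
    solvable G -> pgroups_permute p G ->
    N <| G -> p.-group N -> nilpotent (G / N) ->
  nilpotent G \/ p.-Sylow(G) N.
Proof.
move=> solG permG nsNG pN nilQ; have [sNG nNG] := andP nsNG.
have [S sylS] := Sylow_exists p G; have [sSG pS _] := and3P sylS.
have sNS : N \subset S.
  by apply: subset_trans (pcore_sub_Hall sylS); apply: pcore_max.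
have nsSG : S <| G.
  rewrite -(quotientGK (normalS sNS sSG nsNG)) -(quotientGK nsNG) cosetpre_normal.
  have hS := quotient_pHall (subset_trans sSG nNG) sylS.
  by rewrite (nilpotent_Hall_pcore nilQ hS) pcore_normal.
have [Y hallY] := Hall_exists p^' solG; have [sYG p'Y _] := and3P hallY.
have defG : S * Y = G.
  apply/eqP; rewrite eqEcard mul_subG //= coprime_cardMg ?(pnat_coprime pS) //.
  by rewrite (card_Hall sylS) (card_Hall hallY) partnC.
have [cSY | /subsetPn[k Yk ncSk]] := boolP (Y \subset 'C(S)).
  left; rewrite -defG mulg_nil // (pgroup_nil pS) /=.
  have tiNY : N :&: Y = 1 by apply: coprime_TIg; apply: pnat_coprime pN p'Y.
  rewrite (isog_nil (quotient_isog (subset_trans sYG nNG) tiNY)).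
  by apply: nilpotentS nilQ; apply: quotientS.
right; have Gk := subsetP sYG k Yk; have p'k : p^'.-elt k := mem_p_elt p'Y Yk.
have nUk v : v \in S -> k \in 'N(<[v]>).
  move=> Sv; have sv : <[v]> \subset S by rewrite cycle_subG.
  apply: (@commute_p'elt_norm _ p G S <[v]>%G) => //.
  apply: (permG <[v]>%G <[k]>%G) => //.
  - exact: subset_trans sv sSG.
  - by rewrite cycle_subG.
  exact: pgroupS sv pS.
have [/idPn[] // | sSR] := power_cent_or_comm pS nUk p'k.
suff sSN : S \subset N.
  by have /group_inj-> : N :=: S by apply/eqP; rewrite eqEsubset sNS.
apply: subset_trans sSR _.
rewrite -quotient_cents2 ?(subset_trans sSG) ?cycle_subG ?(subsetP nNG) //.
rewrite centsC; apply: (sub_nilpotent_cent2 nilQ).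
- exact: quotientS.
- by rewrite quotientS ?cycle_subG.
by rewrite coprime_morph // (pnat_coprime pS).
Qed.

End PermutingPGroups.

Section BTStructure.

Variable gT : finGroupType.
Implicit Types (p : nat) (A D H K N P Q R S T U V X Y : {group gT}).

Variable G : {group gT}.
Hypotheses (solG : solvable G) (BTG : BT_group G).
Let L := nilpotent_residual_group G.
Let nsLG : L <| G := nilpotent_residual_normal G.
Let nilGL : nilpotent (G / L) := nilpotent_residual_nil G.
Let abL : abelian L := BT_residual_abelian solG BTG.

(** In other words [L] is a Hall subgroup. This is [pgroups_permute_nil_or_Sylow]
    in the quotient of [G] by the [p']-part of [L], which cannot be nilpotent. *)
Lemma BT_residual_Hall p P :
  p \in \pi(L) -> P \subset G -> p.-group P -> P \subset L.
Proof.
move=> piLp sPG pP; pose N := 'O_p^'(L)%G.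
have nsNG : N <| G by apply: gFnormal_trans.
have p'N : p^'.-group N := pcore_pgroup _ _.
have sNL : N \subset L := pcore_sub _ _.
have pLN : p.-group (L / N).
  have := nilpotent_pcore_Hall p^' (abelian_nil abL).
  by case/and3P=> _ _; rewrite pnatNK /pgroup card_quotient ?gFnorm.
have nilQ : nilpotent (G / N / (L / N)).
  by rewrite (isog_nil (third_isog sNL nsNG nsLG)).
have := pgroups_permute_nil_or_Sylow (quotient_sol N solG)
  (pgroups_permute_quotient nsNG p'N (BT_pgroups_permute solG BTG))
  (quotient_normal N nsLG) pLN nilQ.
have nNG := normal_norm nsNG.
case=> [nilGN | sylLN].
  have /pgroupS/(_ p'N) := nilpotent_residual_sub nsNG nilGN.
  by rewrite p'groupEpi piLp.
rewrite -(quotientSGK (subset_trans sPG nNG) sNL).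
rewrite (sub_normal_Hall sylLN) ?quotient_normal ?quotientS //.
exact: quotient_pgroup.
Qed.

(** A [q]-subgroup [T] of [L] is normalised by the [q']-elements of [G], as it lies
    in the [q]-core, and by the [q]-elements, as these lie in the abelian [L]. *)
Lemma BT_residual_sub_normal X : X \subset L -> X <| G.
Proof.
move=> sXL; have [sLG nLG] := andP nsLG; rewrite /normal (subset_trans sXL) //=.
apply/subsetP=> g Gg; rewrite -cycle_subG -{1}(Sylow_gen X).
apply: norms_gen; apply: norms_bigcup; apply/bigcapsP=> T /SylowP[q q_pr sylT].
have [sTX qT _] := and3P sylT; rewrite cycle_subG.
have sTL := subset_trans sTX sXL.
have sTO : T \subset 'O_q(G).
  apply: subnormal_pcore qT; apply: subnormal_trans (normal_subnormal nsLG).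
  by apply: normal_subnormal; rewrite -sub_abelian_normal.
rewrite -(consttC q g) groupM //; last first.
  by apply: (BT_p'elt_norm_sub_pcore BTG sTO); rewrite ?groupX ?p_elt_constt.
have [T1 | ntT] := eqsVneq T 1.
  by rewrite T1 (subsetP (norms1 [set g.`_q])) ?set11.
have piLq : q \in \pi(L).
  have [_ qdvT _] := pgroup_pdiv qT ntT.
  by rewrite mem_primes q_pr cardG_gt0 (dvdn_trans qdvT) ?cardSg.
have Lg : g.`_q \in L.
  rewrite -cycle_subG; apply: (BT_residual_Hall piLq).
    by rewrite cycle_subG groupX.
  exact: p_elt_constt.
by rewrite (subsetP (cent_sub _)) // (subsetP (centsS sTL abL)).
Qed.

Lemma BT_der1_cent_residual : G^`(1) \subset 'C(L).
Proof.
apply: der1_cent_norm_cycles => v Lv; apply: (@normal_norm _ <[v]>%G).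
by apply: BT_residual_sub_normal; rewrite cycle_subG.
Qed.

Lemma mul_residual_subnormal P : P \subset G -> P <*> L <|<| G.
Proof.
move=> sPG; apply: (nilpotent_quotient_subnormal nsLG nilGL (joing_subr P L)).
by rewrite join_subG sPG normal_sub.
Qed.

Lemma cent_residual_sub_pcore p P :
  P \subset G -> p.-group P -> P \subset 'C(L) -> P \subset 'O_p(G).
Proof.
move=> sPG pP cLP; apply: subnormal_pcore pP.
apply: subnormal_trans (mul_residual_subnormal sPG).
apply: normal_subnormal; rewrite /normal joing_subl join_subG normG.
by rewrite centsC in cLP; rewrite (subset_trans cLP) // cent_sub.
Qed.

Lemma pi'_residual_coprime p P : p.-group P -> p \notin \pi(L) -> coprime #|L| #|P|.
Proof.
move=> pP piL'p; rewrite coprime_sym; apply: pnat_coprime pP _.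
by rewrite -/(pgroup _ _) p'groupEpi.
Qed.

(** [P Q] is a subgroup, and [[P, Q]] lies in [L] since [G / L] is nilpotent. *)
Lemma BT_pi'_residual_cent p q P Q :
    p != q -> p \notin \pi(L) -> q \notin \pi(L) ->
    P \subset G -> Q \subset G -> p.-group P -> q.-group Q -> Q \subset 'C(P).
Proof.
move=> neq_pq piL'p piL'q sPG sQG pP qQ; have [sLG nLG] := andP nsLG.
have p'Q : p^'.-group Q.
  by apply: pi_pgroup qQ _; rewrite !inE eq_sym.
have coPQ : coprime #|P| #|Q| := pnat_coprime pP p'Q.
have cPQ := BT_pgroups_permute solG BTG sPG sQG pP p'Q.
rewrite centsC; apply/commG1P/trivgP.
have <- : (P <*> Q) :&: L = 1.
  rewrite setIC; apply: coprime_TIg; rewrite /= comm_joingE // coprime_cardMg //.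
  by rewrite coprimeMr (pi'_residual_coprime pP) ?(pi'_residual_coprime qQ).
rewrite subsetI; apply/andP; split.
  apply: subset_trans (commgSS (joing_subl P Q) (joing_subr P Q)) _.
  by rewrite commg_subl normG.
rewrite -quotient_cents2 ?(subset_trans sPG) ?(subset_trans sQG) //.
rewrite centsC; apply: (sub_nilpotent_cent2 nilGL); rewrite ?quotientS //.
by rewrite coprime_morph.
Qed.

End BTStructure.

(** * From SST-groups to the commutator condition *)

Section SSPermutable.

Variable gT : finGroupType.
Implicit Types (p : nat) (A D G H K L N P Q R S T U V X Y : {group gT}).

Lemma normal_SS_permutable H K : H <| K -> SS_permutable H K.
Proof.
case/andP=> sHK nHK; split=> //; exists K; split=> //; first exact: mulSGid.
move=> p S _; rewrite inE => /pHall_sub sSK.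
by apply/esym/normC/(subset_trans sSK).
Qed.

Lemma SST_subnormal_SS_permutable G H :
  SST_group G -> H <|<| G -> SS_permutable H G.
Proof. exact: subnormal_transitive_rel normal_SS_permutable. Qed.

(** By counting: [P S] is a [p]-group, and its order is at least the [p]-part of
    that of [G = P K] as [P :&: S] is contained in [P :&: K]. *)
Lemma mul_Sylow_supplement p G P K S :
    P * K = G -> p.-group P -> p.-Sylow(K) S -> commute (P : {set gT}) S ->
  p.-Sylow(G) (P <*> S).
Proof.
move=> defG pP sylS cPS; have [sSK pS _] := and3P sylS.
have sPSG : P <*> S \subset G by rewrite comm_joingE // -defG mulgS.
have pPS : p.-group (P <*> S) by rewrite comm_joingE // pgroupM pP.
rewrite pHallE sPSG eqn_leq dvdn_leq //=; last first.
  by rewrite -(part_pnat_id pPS) partn_dvd ?cardSg.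
have := mul_cardG P K; rewrite -defG => eqK.
have eqS := mul_cardG P S.
have: (#|P * K|%g`_p * #|P :&: K|)%N = (#|P * S|%g * #|P :&: S|)%N.
  rewrite -eqS (card_Hall sylS) -{1}(part_pnat_id pP) -partnM ?cardG_gt0 //.
  rewrite eqK partnM ?cardG_gt0 //; last by rewrite defG cardG_gt0.
  by rewrite [(#|P :&: K|`_p)%N]part_pnat_id //; apply: pgroupS (subsetIl P K) pP.
rewrite defG -(leq_pmul2r (cardG_gt0 (P :&: K))) => -> /=.
by rewrite comm_joingE // leq_mul2l subset_leq_card ?orbT // setIS.
Qed.

Lemma comm_conj_closure_sub N G L K (A : {set gT}) :
    A \subset G -> K \subset G -> L \subset G -> N <| G ->
    (forall l, l \in L -> [~: A, K :^ l] \subset N) ->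
  [~: A, conj_closure K L] \subset N.
Proof.
move=> sAG sKG sLG /andP[_ nNG] comKl.
have sKlG l : l \in L -> K :^ l \subset G.
  by move=> Ll; rewrite -(conjGid (subsetP sLG l Ll)) conjSg.
have sUG : \bigcup_(l in L) K :^ l \subset G by apply/bigcupsP.
rewrite -quotient_cents2 ?(subset_trans sAG) ?gen_subG ?(subset_trans sUG) //.
rewrite centsC quotient_gen ?(subset_trans sUG) // gen_subG.
apply/subsetP=> _ /morphimP[x nx /bigcupP[l Ll Kx] ->].
have cAK : K :^ l / N \subset 'C(A / N).
  have nNKl := subset_trans (sKlG l Ll) nNG.
  by rewrite centsC quotient_cents2 ?(subset_trans sAG) ?comKl.
by rewrite (subsetP cAK) // mem_quotient.
Qed.

End SSPermutable.

Section SupplementCommutator.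

Variable gT : finGroupType.
Implicit Types (p : nat) (A D H K N P Q R S T U V X Y : {group gT}).

Variable G : {group gT}.
Hypotheses (solG : solvable G) (BTG : BT_group G).
Let L := nilpotent_residual_group G.
Let nsLG : L <| G := nilpotent_residual_normal G.

Lemma BT_SS_permutable_mul_residual P :
  P \subset G -> SS_permutable P (P <*> L)%G.
Proof.
move=> sPG; split; first exact: joing_subl.
have nLP := subset_trans sPG (normal_norm nsLG).
exists L; split; [exact: joing_subr | by rewrite /= norm_joinEl |].
move=> q S _; rewrite inE => /pHall_sub sSL; apply: normC.
by rewrite (subset_trans sPG) // normal_norm // BT_residual_sub_normal.
Qed.

Lemma residual_sub_supplement p P K :
  p \notin \pi(L) -> p.-group P -> P * K = G -> K \subset G -> L \subset K.
Proof.
move=> piL'p pP defG sKG; have nLK := subset_trans sKG (normal_norm nsLG).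
have sLG := normal_sub nsLG.
have cPK : commute (P : {set gT}) K.
  by apply/comm_group_setP; rewrite defG groupP.
have dvP : #|L : K| %| #|P|.
  have eqGP : #|G : K| = #|P : K| by rewrite -(indexMg K P) -cPK defG.
  apply: dvdn_trans (dvdn_indexg P K); rewrite -eqGP -indexMg -norm_joinEl //.
  by rewrite indexSg ?joing_subl // join_subG sKG.
have := coprime_dvdr dvP (pi'_residual_coprime pP piL'p).
move/(coprime_dvdl (dvdn_indexg L K)).
by rewrite /coprime gcdnn indexg_eq1.
Qed.

(** A supplement [K] of [P] contains [L], so all the [L]-conjugates of a Sylow
    [p]-subgroup [S] of [K] permute with [P]. The commutators in the [p]-group
    [P (S :^ l)] centralise [L], hence lie in the [p]-core. *)
Lemma SS_permutable_pgroup_commutator p P :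
    p \notin \pi(L) -> prime p -> p.-group P -> SS_permutable P G ->
  exists Kp : {group gT},
         [/\ Kp \subset G, p.-group Kp, is_Syl p G (P * Kp)
           & [~: P, conj_closure Kp L] \subset 'O_p(G)].
Proof.
move=> piL'p p_pr pP [sPG [K [sKG defG permK]]].
have sLK := residual_sub_supplement piL'p pP defG sKG.
have [S sylS] := Sylow_exists p K; have [sSK pS _] := and3P sylS.
have cPS Q : p.-Sylow(K) Q -> commute (P : {set gT}) Q.
  by move=> sylQ; apply: permK p_pr _; rewrite inE.
exists S; split=> //; first exact: subset_trans sSK sKG.
  exists (P <*> S)%G; last by rewrite /= comm_joingE //; apply: cPS.
  by rewrite inE (mul_Sylow_supplement defG) //; apply: cPS.
apply: comm_conj_closure_sub (sPG) _ _ (pcore_normal _ _) _.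
- exact: subset_trans sSK sKG.
- exact: normal_sub.
move=> l Ll; have Kl := subsetP sLK l Ll.
have sylSl : p.-Sylow(K) (S :^ l) by rewrite pHallJ.
have sPSl : p.-Sylow(G) (P <*> S :^ l).
  exact: (mul_Sylow_supplement defG pP sylSl (cPS [group of S :^ l] sylSl)).
have [sPSlG pPSl _] := and3P sPSl.
apply: subset_trans (commgSS (joing_subl P (S :^ l)) (joing_subr P (S :^ l))) _.
apply: cent_residual_sub_pcore => //.
- exact: subset_trans (der_sub 1 _) sPSlG.
- exact: pgroupS (der_sub 1 _) pPSl.
exact: subset_trans (dergS 1 sPSlG) (BT_der1_cent_residual solG BTG).
Qed.

End SupplementCommutator.

(** * Consequences of the commutator condition *)

Section PrimeOrderElements.

Variable gT : finGroupType.
Implicit Types (p : nat) (A D G H K L N P Q R S T U V X Y : {group gT}).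

Lemma expg_fixed_p_elt p (x : gT) i :
  p.-elt x -> x ^+ i = x -> p %| i -> x = 1.
Proof.
move=> px xi p_i; have [m ox] := p_natP px.
have xim n : x ^+ (i ^ n) = x by elim: n => // n IHn; rewrite expnS expgM xi.
by rewrite -(xim m); apply/eqP; rewrite -order_dvdn ox dvdn_exp2r.
Qed.

(** If [x] does not centralise [L] then [[L, x]] is nontrivial, and [x] has no
    nontrivial fixed point in it. *)
Lemma not_cent_prime_elt L (x : gT) :
    abelian L -> x \in 'N(L) -> coprime #|L| #[x] -> x \notin 'C(L) ->
  exists z, [/\ z \in L, prime #[z] & x \notin 'C[z]].
Proof.
move=> abL nLx coLx ncLx.
have nLX : <[x]> \subset 'N(L) by rewrite cycle_subG.
have tiR := coprime_abel_cent_TI nLX coLx abL.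
have sRL : [~: L, <[x]>] \subset L by rewrite commg_subl.
have [R1 | [p p_pr pdvR]] := trivgVpdiv [~: L, <[x]>].
  case/negP: ncLx; rewrite -cycle_subG.
  by apply/commG1P; rewrite commGC.
have [z Rz oz] := Cauchy p_pr pdvR; exists z; split; rewrite ?oz //.
  exact: subsetP sRL z Rz.
apply/cent1P=> cxz; have: z \in 'C_[~: L, <[x]>](<[x]>).
  by rewrite inE Rz cent_cycle; apply/cent1P.
by rewrite tiR => /set1P z1; move: p_pr; rewrite -oz z1 order1.
Qed.

End PrimeOrderElements.

Section ElementSupplement.

Variable gT : finGroupType.
Implicit Types (p : nat) (A D H K N P Q R S T U V X Y : {group gT}).

Variable G : {group gT}.
Hypotheses (solG : solvable G) (BTG : BT_group G).
Let L := nilpotent_residual_group G.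
Let nsLG : L <| G := nilpotent_residual_normal G.
Let abL : abelian L := BT_residual_abelian solG BTG.

(** [K] is a witness of the commutator condition for the [p]-element [x]. *)
Definition elt_supplement p (x : gT) K :=
  [/\ K \subset G, p.-group K, is_Syl p G (<[x]> * K)
           & [~: [set x], conj_closure K L] \subset 'O_p(G)].

(** If [k] in [K] does not centralise [z] then [[k, z]] generates [<[z]>]. As [x]
    commutes with [k] and [k ^ z] modulo the [p]-core, [[x, [k, z]]] lies both in
    [L] and in the [p]-core, so that [x] centralises [[k, z]]. *)
Lemma elt_supplement_cent p (x z : gT) K :
    p \notin \pi(L) -> x \in G -> elt_supplement p x K ->
    z \in L -> prime #[z] ->
  x \in 'C[z] \/ K \subset 'C[z].
Proof.
move=> piL'p Gx [sKG pK _ sRO] Lz pr_z.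
have [|/subsetPn[k Kk nckz]] := boolP (K \subset 'C[z]); [by right | left].
have [sLG nLG] := andP nsLG.
have Gz := subsetP sLG z Lz; have Gk := subsetP sKG k Kk.
have nOG : G \subset 'N('O_p(G)) := gFnorm _ _.
have cOxK l : l \in L -> [~ x, k ^ l] \in 'O_p(G).
  move=> Ll; apply: (subsetP sRO); apply: mem_commg; first exact: set11.
  by apply: mem_gen; apply/bigcupP; exists l; rewrite // memJ_conjg.
have nzG : G \subset 'N(<[z]>).
  apply: (@normal_norm _ <[z]>%G).
  by apply: (BT_residual_sub_normal solG BTG); rewrite cycle_subG.
have zkz : [~ k, z] \in <[z]>.
  rewrite commgEr groupM ?cycle_id //.
  by rewrite memJ_norm ?groupV ?cycle_id ?(subsetP nzG).
have Lkz : [~ k, z] \in L by move: zkz; apply/subsetP; rewrite cycle_subG.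
have Oxkz : [~ x, [~ k, z]] \in 'O_p(G).
  have Gkz : k ^ z \in G by rewrite groupJ.
  have eqkz : [~ k, z] = k^-1 * k ^ z by rewrite commgEl.
  have := cOxK z Lz; have := cOxK 1 (group1 _); rewrite conjg1.
  have toC y :
    y \in G -> [~ x, y] \in 'O_p(G) -> coset 'O_p(G) y \in 'C[coset 'O_p(G) x].
  - move=> Gy Oxy; apply/cent1P/esym/commgP.
    by rewrite -morphR ?(subsetP nOG) //= coset_id.
  move=> /(toC k Gk) ck /(toC _ Gkz) ckz.
  apply: coset_idr; first by rewrite (subsetP nOG) // groupR // groupR.
  have Nx := subsetP nOG x Gx; have Nk := subsetP nOG k Gk.
  have Nkz := subsetP nOG _ Gkz.
  have Nk' : k^-1 \in 'N('O_p(G)) by rewrite groupV.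
  rewrite /= eqkz; set f := coset_morphism 'O_p(G).
  have -> : coset 'O_p(G) [~ x, k^-1 * k ^ z] = f [~ x, k^-1 * k ^ z] by [].
  rewrite /f morphR ?(groupM Nk' Nkz) // morphM // morphV //=.
  by apply/eqP/commgP/commute_sym/cent1P; rewrite groupM ?groupV.
have xkz1 : [~ x, [~ k, z]] = 1.
  have: [~ x, [~ k, z]] \in L :&: 'O_p(G).
    rewrite inE Oxkz andbT commgEr groupM // memJ_norm ?groupV //.
    by rewrite (subsetP nLG).
  rewrite coprime_TIg; first by move/set1P.
  exact: pi'_residual_coprime (pcore_pgroup p G) piL'p.
have defz : <[z]> = <[[~ k, z]]>.
  apply/eqP; rewrite eq_sym eqEcard cycle_subG zkz /=.
  have dvz : #[[~ k, z]] %| #[z] by apply: cardSg; rewrite cycle_subG.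
  have ntkz : #[[~ k, z]] != 1%N.
    by rewrite order_eq1; apply: contra nckz => /commgP ckz; apply/cent1P.
  by rewrite -!orderE (prime_nt_dvdP pr_z ntkz dvz).
rewrite cent1C; apply/(subsetP _ z (cycle_id z)); rewrite defz cycle_subG.
by apply/cent1P/esym/commgP; rewrite xkz1.
Qed.

Lemma BT_Sylow_sub_mul_cent p S1 S2 :
  p.-Sylow(G) S1 -> p.-Sylow(G) S2 -> S1 \subset S2 * 'C_G(L).
Proof.
move=> sylS1 sylS2; have [g Gg ->] := Sylow_trans sylS2 sylS1.
apply/subsetP=> _ /imsetP[t S2t ->]; rewrite -[t ^ g](mulKVg t) -commgEl.
have sS2G := pHall_sub sylS2.
have Gt := subsetP sS2G t S2t.
apply: mem_mulg => //; rewrite inE groupR //.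
by apply: (subsetP (BT_der1_cent_residual solG BTG)); apply: mem_commg.
Qed.

(** Suppose that [k] in [K] does not centralise [L]. There are [z] and [w] of
    prime order in [L] such that [x] moves [z] but not [w], and [k] moves [w] but
    not [z]. So [x * k] moves both, and a witness [Y] for [x * k] fixes both. Since
    [G / 'C_G(L)] is abelian, [x = (x * k) ^+ i] modulo [Y] and ['C_G(L)]: hence
    [x ^+ i = x] modulo the centraliser of [z] and [k ^+ i = 1] modulo that of [w].
    The latter makes [p] divide [i] and contradicts the former. *)
Lemma elt_supplement_cent_residual p (x : gT) K :
    p \notin \pi(L) ->
    (forall y, y \in G -> p.-elt y -> exists K, elt_supplement p y K) ->
    x \in G -> x \notin 'C(L) -> elt_supplement p x K ->
  K \subset 'C(L).
Proof.
move=> piL'p suppG Gx ncLx suppx; have [sLG nLG] := andP nsLG.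
apply: contraT => /subsetPn[k Kk ncLk].
have [sKG pK [S1 ] sylS1 defS1 _] := suppx; rewrite inE in sylS1.
have pS1 := pHall_pgroup sylS1; have sS1G := pHall_sub sylS1.
have S1x : x \in S1 by rewrite -defS1 (subsetP (mulG_subl _ _)) ?cycle_id.
have S1k : k \in S1 by rewrite -defS1 (subsetP (mulG_subr _ _)).
have Gk := subsetP sKG k Kk.
have prim u :
  u \in S1 -> u \notin 'C(L) -> exists z, [/\ z \in L, prime #[z] & u \notin 'C[z]].
- move=> S1u; apply: not_cent_prime_elt => //.
    by rewrite (subsetP nLG) // (subsetP sS1G).
  exact: pi'_residual_coprime (mem_p_elt pS1 S1u : p.-group <[u]>) piL'p.
have [z [Lz pr_z nczx]] := prim x S1x ncLx.
have [w [Lw pr_w ncwk]] := prim k S1k ncLk.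
have czK : K \subset 'C[z].
  by case: (elt_supplement_cent piL'p Gx suppx Lz pr_z) => // /idPn[].
have cwx : x \in 'C[w].
  case: (elt_supplement_cent piL'p Gx suppx Lw pr_w) => // /subsetP/(_ k Kk).
  by rewrite (negPf ncwk).
have czk := subsetP czK k Kk.
have Gy : x * k \in G by rewrite groupM.
have py : p.-elt (x * k) by apply: mem_p_elt pS1 _; rewrite groupM.
have [Y suppy] := suppG _ Gy py.
have czY : Y \subset 'C[z].
  case: (elt_supplement_cent piL'p Gy suppy Lz pr_z) => //.
  by rewrite groupMr // => /idPn[].
have cwY : Y \subset 'C[w].
  case: (elt_supplement_cent piL'p Gy suppy Lw pr_w) => //.
  by rewrite groupMl // => /idPn[].
have [sYG pY [S2 ] sylS2 defS2 _] := suppy; rewrite inE in sylS2.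
have := subsetP (BT_Sylow_sub_mul_cent sylS1 sylS2) x S1x.
rewrite -defS2.
case/mulsgP=> [_ c /mulsgP[_ m /cycleP[i ->] Ym ->] /setIP[Gc cLc] defx].
have Gm := subsetP sYG m Ym.
have nC_G u : u \in L -> G \subset 'N('C_G[u]).
  move=> Lu; apply: (@normal_norm _ 'C_G[u]%G).
  apply: sub_der1_normal; last exact: subsetIl.
  rewrite subsetI der_sub /=.
  apply: subset_trans (BT_der1_cent_residual solG BTG) _.
  by rewrite -cent_cycle; apply: centS; rewrite cycle_subG.
pose Hz := 'C_G[z]%G; have nHzG : G \subset 'N(Hz) := nC_G z Lz.
pose Hw := 'C_G[w]%G; have nHwG : G \subset 'N(Hw) := nC_G w Lw.
have cu u : u \in L -> c \in 'C[u].
  by move=> Lu; rewrite -cent_cycle (subsetP (centS _) c cLc) // cycle_subG.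
have Hwx : x \in Hw by rewrite inE Gx.
have Hwm : m \in Hw by rewrite inE Gm (subsetP cwY).
have Hwc : c \in Hw by rewrite inE Gc cu.
have Hzk : k \in Hz by rewrite inE Gk.
have Hzm : m \in Hz by rewrite inE Gm (subsetP czY).
have Hzc : c \in Hz by rewrite inE Gc cu.
(* [x = (x * k) ^+ i * m * c], where only [x] survives modulo [Hz], and only [k]
   modulo [Hw]. *)
have eqz : coset Hz x ^+ i = coset Hz x.
  rewrite {2}defx !morphM ?groupM ?groupX ?(subsetP nHzG) ?groupM ?groupX //.
  rewrite [X in _ = _ * X]coset_id // mulg1 [X in _ = _ * X]coset_id // mulg1.
  rewrite morphX ?(subsetP nHzG) // morphM ?(subsetP nHzG) //.
  by rewrite [X in (_ * X) ^+ _]coset_id // mulg1.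
have eqw : coset Hw k ^+ i = 1.
  have : coset Hw x = 1 by rewrite coset_id.
  rewrite {1}defx !morphM ?groupM ?groupX ?(subsetP nHwG) ?groupM ?groupX //.
  rewrite [X in _ * X]coset_id // mulg1 [X in _ * X]coset_id // mulg1.
  rewrite morphX ?(subsetP nHwG) // morphM ?(subsetP nHwG) //.
  by rewrite [X in (X * _) ^+ _]coset_id // mul1g.
have p_i : p %| i.
  have pkw : p.-elt (coset Hw k).
    by rewrite morph_p_elt ?(subsetP nHwG) // (mem_p_elt pS1).
  have [m0 ok] := p_natP pkw.
  have: #[coset Hw k] %| i by rewrite order_dvdn eqw.
  apply: dvdn_trans; rewrite ok; case: m0 ok => [|m0] ok; last first.
    by rewrite expnS dvdn_mulr.
  move/eqP: ok; rewrite expn0 order_eq1 => /eqP k1.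
  have := coset_idr (subsetP nHwG k Gk) k1.
  by rewrite inE Gk /= => /idPn[].
have pxz : p.-elt (coset Hz x).
  by rewrite morph_p_elt ?(subsetP nHzG) // (mem_p_elt pS1).
have x1 := expg_fixed_p_elt pxz eqz p_i.
have := coset_idr (subsetP nHzG x Gx) x1.
by rewrite inE Gx /= => /idPn[].
Qed.

(** If [x] in [P] is outside the [p]-core, a witness for [x] is inside, and so
    [<[x]>] covers a Sylow [p]-subgroup modulo the [p]-core. *)
Lemma pgroup_sub_pcore_or_Sylow p P :
    p \notin \pi(L) ->
    (forall y, y \in G -> p.-elt y -> exists K, elt_supplement p y K) ->
    P \subset G -> p.-group P ->
  P \subset 'O_p(G) \/ p.-Sylow(G) (P <*> 'O_p(G)).
Proof.
move=> piL'p suppG sPG pP.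
have [sPO | /subsetPn[x Px nOx]] := boolP (P \subset 'O_p(G)); [by left | right].
have Gx := subsetP sPG x Px; have px := mem_p_elt pP Px.
have ncx : x \notin 'C(L).
  apply: contra nOx; rewrite -cycle_subG => cLx; rewrite -cycle_subG.
  have sxG : <[x]> \subset G by rewrite cycle_subG.
  exact: cent_residual_sub_pcore sxG px cLx.
have [K suppx] := suppG x Gx px.
have cLK := elt_supplement_cent_residual piL'p suppG Gx ncx suppx.
have [sKG pK [S sylS defS] _] := suppx; rewrite inE in sylS.
have sKO := cent_residual_sub_pcore sKG pK cLK.
have sPOG : P <*> 'O_p(G) \subset G by rewrite join_subG sPG pcore_sub.
have nOP : P \subset 'N('O_p(G)) := subset_trans sPG (gFnorm _ _).
have pPO : p.-group (P <*> 'O_p(G)).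
  by rewrite /= norm_joinEl // pgroupM pP pcore_pgroup.
rewrite (sub_pHall sylS pPO _ sPOG) // -defS mul_subG //.
  by rewrite cycle_subG (subsetP (joing_subl _ _)).
exact: subset_trans sKO (joing_subr _ _).
Qed.

End ElementSupplement.

(** * Every subgroup is SS-permutable *)

Section AllSSPermutable.

Variable gT : finGroupType.
Implicit Types (p : nat) (A D H K N P Q R S T U V X Y : {group gT}).

Variable G : {group gT}.
Hypotheses (solG : solvable G) (BTG : BT_group G).
Let L := nilpotent_residual_group G.
Let nsLG : L <| G := nilpotent_residual_normal G.
Let nilGL : nilpotent (G / L) := nilpotent_residual_nil G.

(** Each Sylow subgroup of [H] lies in [H :&: L], lies in [R], or centralises [R];
    so [H] normalises [(H :&: L) R], and then [H R = H (H :&: L) R] is a group. *)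
Lemma BT_commute_Sylow_sub p H R :
    prime p -> p \notin \pi(L) -> H \subset G -> R \subset G -> p.-group R ->
    (forall S, p.-Sylow(H) S -> S \subset R) ->
  commute (H : {set gT}) R.
Proof.
move=> p_pr piL'p sHG sRG pR sSR; have [sLG nLG] := andP nsLG.
pose N := ((H :&: L) <*> R)%G.
have nsHL : H :&: L <| G.
  by apply: BT_residual_sub_normal => //; apply: subsetIr.
have nHL X : X \subset G -> X \subset 'N(H :&: L).
  by move=> sXG; apply: subset_trans sXG (normal_norm nsHL).
have nNH : H \subset 'N(N).
  rewrite -{1}(Sylow_gen H) gen_subG; apply/bigcupsP=> X /SylowP[r r_pr sylX].
  have [sXH rX _] := and3P sylX; have sXG := subset_trans sXH sHG.
  have [piLr | piL'r] := boolP (r \in \pi(L)).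
    apply: (subset_trans _ (normG N)); apply: (subset_trans _ (joing_subl _ _)).
    by rewrite subsetI sXH (BT_residual_Hall solG BTG piLr).
  have [eq_rp | neq_rp] := eqVneq r p.
    apply: (subset_trans _ (normG N)); apply: (subset_trans _ (joing_subr _ _)).
    by apply: sSR; rewrite -eq_rp.
  apply: normsY; first exact: nHL.
  apply: subset_trans (cent_sub R).
  apply: (BT_pi'_residual_cent solG BTG (p := p) (q := r)) => //.
  by rewrite eq_sym.
have defN : N = (H :&: L) * R :> {set gT} by rewrite /= norm_joinEr ?nHL.
have defN' : N = R * (H :&: L) :> {set gT}.
  by rewrite /= joingC norm_joinEl ?nHL.
have : H * ((H :&: L) * R) = R * (H :&: L) * H.
  by rewrite -defN -defN'; apply: normC.
by rewrite mulgA (mulGSid (subsetIl H L)) -mulgA (mulSGid (subsetIl H L)).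
Qed.

(** A normal supplement of [H] is [K = T 'F(G)], with [T] a normal Hall subgroup:
    the set [pi1] consists of the primes [p] not dividing [#|L|] such that the Sylow
    [p]-subgroups of [H] are not in the [p]-core of [G], and [T / L] is the Hall
    [pi1']-subgroup of [G / L]. The Sylow [p]-subgroup of [K] is ['O_p(G)] for [p]
    in [pi1]; for the other primes [p], [K] contains a Sylow [p]-subgroup of
    [G]. *)
Lemma SS_permutable_of_pgroups H :
    (forall p P,
        p \in \pi(G) -> p \notin \pi(L) -> P \subset G -> p.-group P ->
      P \subset 'O_p(G) \/ p.-Sylow(G) (P <*> 'O_p(G))) ->
  H \subset G -> SS_permutable H G.
Proof.
move=> dichG sHG; split=> //; have [sLG nLG] := andP nsLG.
pose pi1 : nat_pred := [pred p : nat | (p \notin \pi(L))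
  && ~~ [forall S in 'Syl_p(H), S \subset 'O_p(G)]].
pose T := (coset L @*^-1 'O_(pi1^')(G / L))%G.
have nsTG : T <| G by rewrite -(quotientGK nsLG) cosetpre_normal pcore_normal.
have sLT : L \subset T := sub_cosetpre _.
have pi1'L : pi1^'.-group L.
  apply/pgroupP=> q q_pr q_dv; rewrite !inE negb_and negbK.
  by rewrite mem_primes q_pr cardG_gt0 q_dv.
have pi1'T : pi1^'.-group T.
  rewrite -(pquotient_pgroup pi1'L) ?(subset_trans (normal_sub nsTG)) //.
  by rewrite /= cosetpreK pcore_pgroup.
pose K := (T <*> 'F(G))%G.
have nsKG : K <| G by apply: normalY (nsTG) (Fitting_normal G).
have sKG := normal_sub nsKG; have nHK := subset_trans sHG (normal_norm nsKG).
have sOK p : 'O_p(G) \subset K.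
  rewrite -p_core_Fitting; apply: subset_trans (pcore_sub _ _) (joing_subr _ _).
have sOR p R : p.-Sylow(K) R -> 'O_p(G) \subset R.
  move=> sylR; apply: subset_trans (pcore_sub_Hall sylR).
  apply: pcore_max (pcore_pgroup _ _) _.
  exact: normalS (sOK p) sKG (pcore_normal p G).
exists K; split=> //.
  rewrite -norm_joinEl //; apply/eqP; rewrite eqEsubset join_subG sHG sKG /=.
  (* [H <*> K] contains a Sylow [p]-subgroup of [G] for every [p]. *)
  pose SS := [set P : {group gT} | (P \subset H <*> K) && (P \subset G)].
  suff defG : <<\bigcup_(P in SS) P>> = G.
    have: <<\bigcup_(P in SS) P>> \subset H <*> K.
      by rewrite gen_subG; apply/bigcupsP=> P; rewrite inE => /andP[].
    by rewrite defG.
  apply: Sylow_transversal_gen => [P|]; first by rewrite inE => /andP[].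
  move=> p piGp; have [pi1p | pi1'p] := boolP (p \in pi1).
    case/andP: (pi1p) => piL'p /forall_inPn[S]; rewrite inE => sylS nsSO.
    have [sSH pS _] := and3P sylS; have sSG := subset_trans sSH sHG.
    have [/idPn[] // | sylSO] := dichG p S piGp piL'p sSG pS.
    exists (S <*> 'O_p(G))%G => //; rewrite inE (pHall_sub sylSO) andbT.
    rewrite join_subG (subset_trans sSH) ?joing_subl //.
    by rewrite (subset_trans (sOK p)) ?joing_subr.
  have [S sylS] := Sylow_exists p G; have [sSG pS _] := and3P sylS.
  exists S => //; rewrite inE sSG andbT.
  apply: subset_trans (joing_subr _ _); apply: subset_trans (joing_subl _ _).
  rewrite -sub_quotient_pre ?(subset_trans sSG) //.
  rewrite sub_Hall_pcore ?nilpotent_pcore_Hall ?quotientS //.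
  by apply: quotient_pgroup; apply: pi_pgroup pS _.
move=> p R p_pr; rewrite inE => sylR; have [sRK pR _] := and3P sylR.
have sRG := subset_trans sRK sKG.
have normC' : R <| G -> commute (H : {set gT}) R.
  by move=> nsRG; apply: normC; apply: subset_trans sHG (normal_norm nsRG).
have [piLp | piL'p] := boolP (p \in \pi(L)).
  apply/normC'/BT_residual_sub_normal => //.
  exact: (BT_residual_Hall solG BTG piLp).
(* For [p] in [pi1] the order of [T] is prime to [p], so [R = 'O_p(G)]. *)
have [pi1p | ] := boolP (p \in pi1).
  apply: normC'; suff -> : R :=: 'O_p(G) by apply: pcore_normal.
  apply/eqP; rewrite eq_sym eqEcard sOR // (card_Hall sylR) -p_core_Fitting.
  rewrite (card_Hall (nilpotent_pcore_Hall p (Fitting_nil G))).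
  have dvK : #|K| %| #|T| * #|'F(G)|.
    rewrite /= norm_joinEr ?dvdn_cardMg //.
    by rewrite (subset_trans (Fitting_sub G)) ?normal_norm.
  have := partn_dvd p _ dvK; rewrite muln_gt0 !cardG_gt0 => /(_ isT).
  rewrite partnM ?cardG_gt0 // [X in _ %| X * _]part_p'nat ?mul1n; last first.
    by apply: (pi'_p'group pi1'T).
  by apply: dvdn_leq; rewrite part_gt0.
rewrite !inE piL'p /= negbK => /forall_inP sSO.
apply: (BT_commute_Sylow_sub p_pr) => // S sylS.
by apply: subset_trans (sSO S _) (sOR p R sylR); rewrite inE.
Qed.

End AllSSPermutable.

Theorem theorem1p13 (gT : finGroupType) (G L : {group gT})
    (solG : solvable G) (BTG : BT_group G)
    (defL : L = nilpotent_residual G :> {set gT}) :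
  [<-> SST_group G;
       forall p : nat, p \in \pi(G) -> p \notin \pi(L) ->
       forall P : {group gT}, P \subset G -> p.-group P ->
       exists Kp : {group gT},
         [/\ Kp \subset G, p.-group Kp, is_Syl p G (P * Kp)
           & [~: P, conj_closure Kp L] \subset 'O_p(G)];
       forall p : nat, p \in \pi(G) -> p \notin \pi(L) ->
       forall x : gT, x \in G -> p.-elt x ->
       exists Kp : {group gT},
         [/\ Kp \subset G, p.-group Kp, is_Syl p G (<[x]> * Kp)
           & [~: [set x], conj_closure Kp L] \subset 'O_p(G)]].
Proof.
have {defL} -> : L = nilpotent_residual_group G by apply: group_inj.
tfae.
- move=> SSTG p piGp piL'p P sPG pP.
  have p_pr : prime p by move: piGp; rewrite mem_primes => /andP[].
  apply: SS_permutable_pgroup_commutator => //.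
  apply: (SSTG P (P <*> nilpotent_residual_group G)%G).
  + exact: joing_subl.
  + by rewrite join_subG sPG normal_sub // nilpotent_residual_normal.
  + exact: (BT_SS_permutable_mul_residual solG BTG sPG).
  exact/SST_subnormal_SS_permutable/mul_residual_subnormal.
- move=> cond2 p piGp piL'p x Gx px.
  have sxG : <[x]> \subset G by rewrite cycle_subG.
  have [K [sKG pK sylK sRO]] := cond2 p piGp piL'p <[x]>%G sxG px.
  exists K; split=> //; apply: subset_trans sRO; apply: commSg.
  by rewrite sub1set cycle_id.
move=> cond3 H K sHK sKG _ _.
apply: (SS_permutable_of_pgroups solG BTG); last exact: subset_trans sKG.
move=> p P piGp piL'p sPG pP; apply: (pgroup_sub_pcore_or_Sylow solG BTG) => //.
exact: cond3.
Qed.
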